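(* Let $C=\mathtt{while}(\varphi)\{C_{\mathrm{body}}\}[I]$ be a (possibly nested) $\mathsf{pGCL}$ loop and let $f\in\mathbb{E}$. If $\mathrm{vc}^{\mathsf{dPASTSUBINV},\mathrm{awp}}[\![C]\!](f)$ holds, then $\mathrm{awp}[\![C]\!](f)\ge I$.
   Context: States: fix a countably infinite set of program variables with values in $\mathbb{Q}_{\ge 0}$; a state is a map $\sigma$ from variables to $\mathbb{Q}_{\ge0}$ which is $0$ for all but finitely many variables; $\mathsf{States}$ is the set of states. A predicate is a map $\varphi:\mathsf{States}\to\{\mathsf{true},\mathsf{false}\}$. Expectations: $\mathbb{E}$ is the set of maps $\mathsf{States}\to[0,\infty]$, ordered pointwise ($\le,\ge$); $+,\cdot$ pointwise with $0\cdot\infty=0$; $\sqcap,\sqcup$ pointwise min/max; $[\varphi]$ Iverson bracket; $(\varphi\to g)(\sigma)=g(\sigma)$ if $\sigma\models\varphi$, else $\infty$; $f[x/E](\sigma)=f(\sigma[x\mapsto E(\sigma)])$. Programs of $\mathsf{pGCL}$: $C ::= \mathtt{skip} \mid x:=E \mid C;C \mid \mathtt{if}\ \varphi_1\to C\ \square\ \varphi_2\to C \mid \{C\}[p]\{C\} \mid \mathtt{while}(\varphi)\{C\}[I]$, where $E:\mathsf{States}\to\mathbb{Q}_{\ge0}$, $p:\mathsf{States}\to[0,1]$, in every guarded choice $\varphi_1\vee\varphi_2$ is valid (when both hold the choice is nondeterministic), and every loop carries an invariant annotation $I\in\mathbb{E}$. Weakest preexpectations for $\mathcal{T}\in\{\mathrm{dwp},\mathrm{awp}\}$: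 $\mathcal{T}[\![\mathtt{skip}]\!](f)=f$; $\mathcal{T}[\![x:=E]\!](f)=f[x/E]$; $\mathcal{T}[\![C_1;C_2]\!](f)=\mathcal{T}[\![C_1]\!](\mathcal{T}[\![C_2]\!](f))$; $\mathrm{dwp}$ of a guarded choice: $(\varphi_1\to\mathrm{dwp}[\![C_1]\!](f))\sqcap(\varphi_2\to\mathrm{dwp}[\![C_2]\!](f))$; $\mathrm{awp}$ of a guarded choice: $[\varphi_1]\cdot\mathrm{awp}[\![C_1]\!](f)\sqcup[\varphi_2]\cdot\mathrm{awp}[\![C_2]\!](f)$; $\mathcal{T}[\![\{C_1\}[p]\{C_2\}]\!](f)=p\cdot\mathcal{T}[\![C_1]\!](f)+(1-p)\cdot\mathcal{T}[\![C_2]\!](f)$; loops: least fixpoint of $g\mapsto[\neg\varphi]\cdot f+[\varphi]\cdot\mathcal{T}[\![C']\!](g)$. $\mathrm{awp}^*$ follows the $\mathrm{awp}$ rules except $\mathrm{awp}^*[\![\mathtt{while}(\varphi)\{C'\}[I]]\!](f)=I$. A loop is dPAST (positively demonically almost-surely terminating) if its expected runtime (in the sense of the expected-runtime calculus of Kaminski et al., resolving nondeterminism in the worst case) is finite for all initial states. A loop $\mathtt{while}(\varphi)\{C_{\mathrm{body}}\}[I]$ is suitable for optional stopping w.r.t. $f$ if (i) $I=[\varphi]\cdot I'+[\neg\varphi]\cdot f$ for some $I'\in\mathbb{E}$, (ii) $f$, $I$ and $[\varphi]\cdot\mathrm{awp}[\![C_{\mathrm{body}}]\!](I)+[\neg\varphi]\cdot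 f$ are pointwise $<\infty$, and (iii) there is $b\in\mathbb{R}_{\ge0}$ with $([\varphi]\cdot\mathrm{awp}[\![C_{\mathrm{body}}]\!](\lambda\tau.|I(\tau)-I(\sigma)|))(\sigma)\le b$ for all $\sigma$. The provider $\mathsf{dPASTSUBINV}$ assigns to a loop $L=\mathtt{while}(\varphi)\{C_{\mathrm{body}}\}[I]$ and $g\in\mathbb{E}$ the value $\mathsf{true}$ iff $[\varphi]\cdot\mathrm{awp}^*[\![C_{\mathrm{body}}]\!](I)+[\neg\varphi]\cdot g\ge I$, $L$ is dPAST, and $L$ is suitable for optional stopping w.r.t. $g$. For a provider $\mathfrak{C}$ (a map from annotated loops and expectations to truth values), $\mathrm{vc}^{\mathfrak{C},\mathrm{awp}}[\![C]\!](f)$ is defined inductively: $\mathsf{true}$ for $\mathtt{skip}$ and assignments; $\mathrm{vc}[\![C_1]\!](\mathrm{awp}^*[\![C_2]\!](f))\wedge\mathrm{vc}[\![C_2]\!](f)$ for $C_1;C_2$; $\mathrm{vc}[\![C_1]\!](f)\wedge\mathrm{vc}[\![C_2]\!](f)$ for guarded and probabilistic choices; $\mathfrak{C}(\mathtt{while}(\varphi)\{C'\}[I],f)\wedge\mathrm{vc}[\![C']\!](I)$ for loops. *)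

(* Defs.v *)
From HB Require Import structures.
From mathcomp Require Import all_boot all_order all_algebra.
From mathcomp Require Import boolp classical_sets reals ereal.
Set Implicit Arguments. Unset Strict Implicit. Unset Printing Implicit Defensive.
Import Order.TTheory GRing.Theory Num.Theory.
Local Open Scope ring_scope.

Record State := mkState {
  sval : nat -> rat ;
  sval_nn : forall x, 0 <= sval x ;
  sval_fin : exists n, forall x, (n <= x)%N -> sval x = 0 }.

Definition qnn := {q : rat | 0 <= q}.

Definition upd_fun (s : State) (x : nat) (q : rat) : nat -> rat :=
  fun y => if y == x then q else sval s y.

Lemma upd_nn (s : State) x (q : qnn) : forall y, 0 <= upd_fun s x (proj1_sig q) y.
Proof. by move=> y; rewrite /upd_fun; case: eqP => _; [exact: (proj2_sig q)|exact: sval_nn]. Qed.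

Lemma upd_fin (s : State) x (q : rat) :
  exists n, forall y, (n <= y)%N -> upd_fun s x q y = 0.
Proof.
case: (sval_fin s) => n Hn; exists (maxn n x.+1) => y Hy; rewrite /upd_fun.
case: eqP => [E|_]; first by subst y; move: Hy; rewrite geq_max ltnn andbF.
by apply: Hn; move: Hy; rewrite geq_max => /andP[].
Qed.

Definition upd (s : State) (x : nat) (q : qnn) : State :=
  mkState (upd_nn s x q) (upd_fin s x (proj1_sig q)).

Definition pred_st := State -> bool.
Definition expr := State -> qnn.

Local Open Scope ereal_scope.

(* Expectations: maps States -> [0,oo], represented in \bar R; membership in
   E is the predicate [expect] below. *)
Definition expec (R : realType) := State -> \bar R.
Definition expect (R : realType) (g : expec R) := forall s, 0 <= g s.

Definition iv (R : realType) (phi : pred_st) (s : State) : \bar R :=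
  if phi s then 1 else 0.

(* least fixpoint (Knaster-Tarski) in the complete lattice E of expectations *)
Definition lfp (R : realType) (F : expec R -> expec R) : expec R :=
  fun s => ereal_inf [set g s | g in [set g : expec R | expect g /\ forall t, F g t <= g t]].

Inductive prog (R : realType) :=
| Skip
| Assign (x : nat) (E : expr)
| Seq (c1 c2 : prog R)
| GChoice (phi1 : pred_st) (c1 : prog R) (phi2 : pred_st) (c2 : prog R)
| PChoice (p : State -> R) (c1 c2 : prog R)
| While (phi : pred_st) (body : prog R) (I : expec R).
Arguments Skip {R}.
Arguments Assign {R}.

Fixpoint wf (R : realType) (c : prog R) : Prop :=
  match c with
  | Skip | Assign _ _ => True
  | Seq c1 c2 => wf c1 /\ wf c2
  | GChoice phi1 c1 phi2 c2 => (forall s, phi1 s || phi2 s) /\ wf c1 /\ wf c2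
  | PChoice p c1 c2 => (forall s, (0 <= p s <= 1)%R) /\ wf c1 /\ wf c2
  | While _ body Inv => expect Inv /\ wf body
  end.

Fixpoint awp (R : realType) (c : prog R) (f : expec R) : expec R :=
  match c with
  | Skip => f
  | Assign x E => fun s => f (upd s x (E s))
  | Seq c1 c2 => awp c1 (awp c2 f)
  | GChoice phi1 c1 phi2 c2 =>
      fun s => maxe (iv R phi1 s * awp c1 f s) (iv R phi2 s * awp c2 f s)
  | PChoice p c1 c2 =>
      fun s => (p s)%:E * awp c1 f s + (1 - p s)%:E * awp c2 f s
  | While phi body _ =>
      lfp (fun g s => iv R (fun t => ~~ phi t) s * f s + iv R phi s * awp body g s)
  end.

Fixpoint awps (R : realType) (c : prog R) (f : expec R) : expec R :=
  match c with
  | Skip => f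
  | Assign x E => fun s => f (upd s x (E s))
  | Seq c1 c2 => awps c1 (awps c2 f)
  | GChoice phi1 c1 phi2 c2 =>
      fun s => maxe (iv R phi1 s * awps c1 f s) (iv R phi2 s * awps c2 f s)
  | PChoice p c1 c2 =>
      fun s => (p s)%:E * awps c1 f s + (1 - p s)%:E * awps c2 f s
  | While _ _ Inv => Inv
  end.

(* expected runtime calculus (Kaminski et al.), nondeterminism resolved
   demonically (worst case = max) *)
Fixpoint ert (R : realType) (c : prog R) (t : expec R) : expec R :=
  match c with
  | Skip => fun s => 1 + t s
  | Assign x E => fun s => 1 + t (upd s x (E s))
  | Seq c1 c2 => ert c1 (ert c2 t)
  | GChoice phi1 c1 phi2 c2 =>
      fun s => 1 + maxe (iv R phi1 s * ert c1 t s) (iv R phi2 s * ert c2 t s)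
  | PChoice p c1 c2 =>
      fun s => 1 + ((p s)%:E * ert c1 t s + (1 - p s)%:E * ert c2 t s)
  | While phi body _ =>
      lfp (fun X s => 1 + (iv R (fun u => ~~ phi u) s * t s + iv R phi s * ert body X s))
  end.

Definition dPAST (R : realType) (phi : pred_st) (body : prog R) (I : expec R) : Prop :=
  forall s, ert (While phi body I) (fun _ => 0) s < +oo.

Definition suitable_OST (R : realType) (phi : pred_st) (body : prog R) (I : expec R)
    (f : expec R) : Prop :=
  [/\ exists I' : expec R, expect I' /\
        I = (fun s => iv R phi s * I' s + iv R (fun t => ~~ phi t) s * f s),
      (forall s, f s < +oo) /\ (forall s, I s < +oo) /\
        (forall s, iv R phi s * awp body I s + iv R (fun t => ~~ phi t) s * f s < +oo) &
      exists b : R, (0 <= b)%R /\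
        forall s, iv R phi s * awp body (fun t => `|I t - I s|) s <= b%:E].

Definition provider (R : realType) := pred_st -> prog R -> expec R -> expec R -> Prop.

Definition dPASTSUBINV (R : realType) : provider R :=
  fun phi body I g =>
    [/\ (forall s, I s <= iv R phi s * awps body I s + iv R (fun t => ~~ phi t) s * g s),
        dPAST phi body I & suitable_OST phi body I g].

Fixpoint vc (R : realType) (P : provider R) (c : prog R) (f : expec R) : Prop :=
  match c with
  | Skip | Assign _ _ => True
  | Seq c1 c2 => vc P c1 (awps c2 f) /\ vc P c2 f
  | GChoice _ c1 _ c2 => vc P c1 f /\ vc P c2 f
  | PChoice _ c1 c2 => vc P c1 f /\ vc P c2 f
  | While phi body Inv => P phi body Inv f /\ vc P body Inv
  end.

(* Main.v *)
(* A nondeterministic body is resolved by choosing, in every state, a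
   sub-probability functional below [awp body]; [awp] is the supremum over these
   choices ([awp_tight]).  In a loop, choose in each state a resolution K that
   attains I up to an additive e.  The runtime X satisfies 1 + K X <= X, so K has
   finite expected lifetime, and the total loss caused by e is at most e * X.
   What remains is K^n I -> 0 for this fixed K.  The conditional difference bound
   gives K^n I <= I * K^n 1 + b * S_n with S_n the sum of K^k 1 over k < n, hence
   K^(m+n) I <= K^m (I * K^n 1) + b * K^m S_n; the second term is a tail of the
   convergent series S, and for fixed m the first one vanishes by dominated
   convergence.  Fixing K first is essential: the supremum over all resolutions
   of K^n I need not tend to 0. *)
Require Import Defs.
From mathcomp Require Import all_boot all_order all_algebra.
From mathcomp Require Import boolp classical_sets reals ereal.
From mathcomp Require Import topology normedtype sequences.
Import Order.TTheory GRing.Theory Num.Theory.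
Import numFieldNormedType.Exports.
Set Implicit Arguments. Unset Strict Implicit. Unset Printing Implicit Defensive.
Local Open Scope classical_set_scope.
Local Open Scope ereal_scope.

(** * Monotone approximation of suprema; sub-probability functionals and kernels *)

(** An attained supremum is approached by the constant sequence; otherwise explicit sequences
    strictly below it work, each term being dominated by some member of [A]. Monotonicity of [a] is
    what lets [subprob_cvg] apply later. *)
Lemma ereal_sup_nondecreasing_seq (R : realType) (A : set (\bar R)) :
  A !=set0 -> (forall y, A y -> 0 <= y) ->
  exists a : nat -> \bar R, [/\ {homo a : m n / (m <= n)%N >-> m <= n},
    forall k, 0 <= a k, forall k, exists2 y, A y & a k <= y &
    a @ \oo --> ereal_sup A].
Proof.
move=> [y0 Ay0] A0.
have sup0 : 0 <= ereal_sup A.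
  by apply: le_trans (A0 _ Ay0) _; exact: ereal_sup_ubound.
have [Asup|NAsup] := pselect (A (ereal_sup A)).
  exists (fun=> ereal_sup A); split => //; last exact: cvg_cst.
  by move=> _; exists (ereal_sup A).
have suplt k : k < ereal_sup A -> exists2 y, A y & k <= y.
  by move=> /ereal_sup_gt[y Ay ky]; exists y => //; exact: ltW.
have sup_gt0 : 0 < ereal_sup A.
  rewrite lt_neqAle sup0 andbT; apply/eqP => E; apply: NAsup.
  suff -> : ereal_sup A = y0 by [].
  by apply/eqP; rewrite eq_le ereal_sup_ubound// andbT -E A0.
case: (ereal_sup A) sup0 suplt sup_gt0 => [r| |] //.
- rewrite !lte_fin => _ suplt r0.
  (* Since [harmonic k] is 1/(k+1), the sequence starts at 0 and never reaches [r]. *)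
  exists (fun k => (r - r * harmonic k)%:E); split.
  + move=> m n mn; rewrite lee_fin lerD2l lerN2 ler_pM2l//= lef_pV2 ?posrE//.
    by rewrite ler_nat.
  + move=> k; rewrite lee_fin subr_ge0 -[leRHS]mulr1 ler_pM2l//= invf_le1//.
    by rewrite ler1n.
  + move=> k; apply: suplt; rewrite lte_fin ltrBlDr ltrDl mulr_gt0//.
    by rewrite /= invr_gt0 ltr0n.
  + apply: cvg_EFin; first exact: nearW.
    rewrite -[X in _ --> X]subr0 -[X in (_ - X)%R](mulr0 r).
    apply: cvgB; first exact: cvg_cst.
    by apply: cvgMr; exact: cvg_harmonic.
- move=> _ suplt _; exists (fun k => k%:R%:E); split.
  + by move=> m n mn; rewrite lee_fin ler_nat.
  + by move=> k; rewrite lee_fin.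
  + by move=> k; apply: suplt; rewrite ltry.
  + exact/cvgeryP/cvgr_idn.
Qed.

(* Integration against a sub-probability measure, kept abstract as a functional;
   the values outside [expect] are irrelevant. *)
Record subprob (R : realType) (mu : expec R -> \bar R) : Prop := Subprob {
  subprob_ge0 : forall g, expect g -> 0 <= mu g ;
  subprob_le : forall g h, expect g -> (forall t, g t <= h t) -> mu g <= mu h ;
  subprobD : forall g h, expect g -> expect h ->
    mu (fun t => g t + h t) = mu g + mu h ;
  subprobZ : forall (c : R) g, (0 <= c)%R -> expect g ->
    mu (fun t => c%:E * g t) = c%:E * mu g ;
  subprob1 : mu (fun=> 1) <= 1 ;
  subprob_cvg : forall (u : nat -> expec R) g, (forall n, expect (u n)) ->
    (forall t, {homo u^~ t : m n / (m <= n)%N >-> m <= n}) ->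
    (forall t, u^~ t @ \oo --> g t) -> mu \o u @ \oo --> mu g }.

Lemma subprob_cst0 (R : realType) (mu : expec R -> \bar R) :
  subprob mu -> mu (fun=> 0) = 0.
Proof.
move=> smu; have := subprobZ smu (lexx 0%R) (fun _ : State => lexx (0 : \bar R)).
by rewrite mule0 => ->; exact: mul0e.
Qed.

Definition kernel (R : realType) (K : expec R -> expec R) :=
  forall s, subprob (fun g => K g s).

Lemma subprob_dirac (R : realType) (s : State) : subprob (fun g : expec R => g s).
Proof.
by split => // u g _ _; exact.
Qed.

Lemma expect_cvg (R : realType) (u : nat -> expec R) g : (forall n, expect (u n)) ->
  (forall t, u^~ t @ \oo --> g t) -> expect g.
Proof.
move=> u0 ug t; apply: (cvge_to_ge (ug t)).
by apply: nearW => n; exact: u0.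
Qed.

(** Total weight below 1 is allowed, so that weights 0 and 0 yield the zero functional in
    [subprob0]. *)
Lemma subprob_mix (R : realType) (p q : R) (mu nu : expec R -> \bar R) :
  (0 <= p)%R -> (0 <= q)%R -> (p + q <= 1)%R -> subprob mu -> subprob nu ->
  subprob (fun g => p%:E * mu g + q%:E * nu g).
Proof.
move=> p0 q0 pq [mu0 mul muD muZ mu1 muc] [nu0 nul nuD nuZ nu1 nuc]; split.
- by move=> g g0; rewrite adde_ge0// mule_ge0// ?lee_fin// ?mu0// nu0.
- by move=> g h g0 gh; rewrite leeD// lee_wpmul2l// ?lee_fin// ?mul// nul.
- move=> g h g0 h0; rewrite muD// nuD// !ge0_muleDr ?mu0 ?nu0//.
  by rewrite addeACA.
- move=> c g c0 g0; rewrite muZ// nuZ// ge0_muleDr ?mule_ge0 ?lee_fin ?mu0 ?nu0//.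
  by rewrite !muleA -!EFinM !(mulrC c).
- apply: (@le_trans _ _ (p + q)%:E); last by rewrite lee_fin.
  rewrite EFinD leeD// -[leRHS]mule1 lee_wpmul2l// lee_fin.
- move=> u g u0 ui ug; have g0 := expect_cvg u0 ug.
  apply: cvgeD; first by rewrite ge0_adde_def// inE mule_ge0// ?lee_fin ?mu0 ?nu0.
  + by apply: cvgeZl => //; exact: muc.
  + by apply: cvgeZl => //; exact: nuc.
Qed.

Lemma subprob0 (R : realType) : subprob (fun=> 0 : \bar R).
Proof.
have s0 : State by exists (fun=> 0%R) => //; exists 0%N.
have d := @subprob_dirac R s0.
have := @subprob_mix R 0 0 _ _ (lexx _) (lexx _) _ d d.
rewrite addr0 ler01 => /(_ isT).
by under eq_fun do rewrite !mul0e adde0.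
Qed.

Lemma kernel_expect (R : realType) (K : expec R -> expec R) g :
  kernel K -> expect g -> expect (K g).
Proof. by move=> kK g0 s; exact: (subprob_ge0 (kK s)). Qed.

(** Sequential composition: first [mu], then [K] from the state reached. Monotone convergence
    survives because [K] maps a nondecreasing sequence to one whose limit is again pointwise. *)
Lemma subprob_bind (R : realType) (mu : expec R -> \bar R) (K : expec R -> expec R) :
  subprob mu -> kernel K -> subprob (mu \o K).
Proof.
move=> [mu0 mul muD muZ mu1 muc] kK; split => /=.
- by move=> g g0; apply/mu0/kernel_expect.
- move=> g h g0 gh; apply: mul; first exact: kernel_expect.
  by move=> t; exact: (subprob_le (kK t)).
- move=> g h g0 h0; rewrite -muD; [|exact: kernel_expect..].
  by congr mu; apply/funext => t; exact: (subprobD (kK t)).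
- move=> c g c0 g0; rewrite -muZ//; last exact: kernel_expect.
  by congr mu; apply/funext => t; exact: (subprobZ (kK t)).
- apply: le_trans mu1; apply: mul; first by apply: kernel_expect => // t.
  by move=> t; exact: (subprob1 (kK t)).
- move=> u g u0 ui ug; apply: (muc (K \o u)).
  + by move=> n; exact: kernel_expect.
  + by move=> t m n mn; apply: (subprob_le (kK t)) => // t'; exact: ui.
  + by move=> t; exact: (subprob_cvg (kK t)).
Qed.

(** * Resolutions of a transformer and tightness *)

(** One [mu] lies below [T] against all expectations at once: the same choice later serves the
    invariant, the runtime and the increments. *)
Definition resolves (R : realType) (T : expec R -> expec R) (s : State)
    (mu : expec R -> \bar R) :=
  subprob mu /\ forall g, expect g -> mu g <= T g s.

(** [T] is the upper envelope of its resolutions; the converse inequality is built into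
    [resolves]. *)
Definition tight (R : realType) (T : expec R -> expec R) :=
  (forall g, expect g -> expect (T g)) /\
  forall g s, expect g -> T g s <= ereal_sup [set mu g | mu in resolves T s].

Lemma resolves0 (R : realType) (T : expec R -> expec R) s :
  (forall g, expect g -> expect (T g)) -> resolves T s (fun=> 0).
Proof. by move=> T0; split; [exact: subprob0|move=> g g0; exact: T0]. Qed.

Lemma sup_resolves_seq (R : realType) (T : expec R -> expec R) g s :
  (forall g, expect g -> expect (T g)) -> expect g ->
  exists a : nat -> \bar R, [/\ {homo a : m n / (m <= n)%N >-> m <= n},
    forall k, 0 <= a k, forall k, exists2 mu, resolves T s mu & a k <= mu g &
    a @ \oo --> ereal_sup [set mu g | mu in resolves T s]].
Proof.
move=> T0 g0.
have [||a [ai a0 aA ac]] :=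
    @ereal_sup_nondecreasing_seq R [set mu g | mu in resolves T s].
- by exists 0; exists (fun=> 0) => //; exact: resolves0.
- by move=> _ [mu [smu _] <-]; exact: (subprob_ge0 smu).
by exists a; split => // k; have [_ [mu rmu <-] amu] := aA k; exists mu.
Qed.

(* [G] is not assumed to be [T g]: in the loop case it is the supremum itself,
   which is not yet known to coincide with [T g]. *)
Lemma subprob_le_bind (R : realType) (T : expec R -> expec R) mu g G B :
  (forall g, expect g -> expect (T g)) -> expect g -> subprob mu -> expect G ->
  (forall t, G t <= ereal_sup [set nu g | nu in resolves T t]) ->
  (forall K, (forall t, resolves T t (fun h => K h t)) -> mu (K g) <= B) ->
  mu G <= B.
Proof.
move=> T0 g0 smu G0 Gsup KB.
(* Near-optimal resolutions need not increase with [k], but their lower bounds [a] do, and [mu]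
   commutes with the limit of these. *)
have /choice[a aP] := fun t => @sup_resolves_seq R T g t T0 g0.
pose G' t := ereal_sup [set nu g | nu in resolves T t].
apply: (@le_trans _ _ (mu G')); first exact: (subprob_le smu).
have a0 k : expect (a^~ k) by move=> t; have [_ + _ _] := aP t; exact.
have := @subprob_cvg _ _ smu (fun k t => a t k) G' a0.
have ai t : {homo (fun k => a t k) : m n / (m <= n)%N >-> m <= n}.
  by have [] := aP t.
move=> /(_ ai) /(_ (fun t => _)) aG.
have {}aG : (fun k => mu (a^~ k)) @ \oo --> mu G'.
  by apply: aG => t; have [] := aP t.
apply: (cvge_to_le aG); apply: nearW => k.
have /choice[nu nuP] : forall t, exists nu, resolves T t nu /\ a t k <= nu g.
  by move=> t; have [_ _ /(_ k)[nu ? ?] _] := aP t; exists nu.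
apply: le_trans (KB (fun h t => nu t h) _); last by move=> t; have [] := nuP t.
by apply: (subprob_le smu) => // t; have [] := nuP t.
Qed.

(** Monotonicity is inherited from the resolutions, each of which is monotone. *)
Lemma tight_le (R : realType) (T : expec R -> expec R) g h s : tight T ->
  expect g -> (forall t, g t <= h t) -> T g s <= T h s.
Proof.
move=> [_ tT] g0 gh; apply: le_trans (tT _ _ g0) _.
apply: ge_ereal_sup => _ [mu [smu muT] <-].
have h0 : expect h by move=> t; exact: le_trans (g0 t) (gh t).
by apply: le_trans (muT _ h0); exact: (subprob_le smu).
Qed.

(** * Tightness of the loop-free constructs *)

Lemma tight_id (R : realType) : tight (fun g : expec R => g).
Proof.
split => // g s g0; apply: ereal_sup_ubound; exists (fun g => g s) => //.
by split => //; exact: subprob_dirac.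
Qed.

Lemma tight_assign (R : realType) x (E : expr) :
  tight (fun (g : expec R) s => g (upd s x (E s))).
Proof.
split => [g g0 s|g s g0]; first exact: g0.
apply: ereal_sup_ubound; exists (fun g => g (upd s x (E s))) => //.
by split => //; exact: subprob_dirac.
Qed.

(** A resolution of [T1] followed by a kernel of resolutions of [T2] resolves the composition. *)
Lemma tight_comp (R : realType) (T1 T2 : expec R -> expec R) :
  tight T1 -> tight T2 -> tight (T1 \o T2).
Proof.
move=> t1 [T20 t2]; have [T10 T1sup] := t1.
split => [g g0|g s g0 /=]; first exact/T10/T20.
apply: le_trans (T1sup _ _ (T20 _ g0)) _; apply: ge_ereal_sup => _ [mu [smu muT] <-].
apply: (subprob_le_bind T20 g0 smu (T20 _ g0)) => [t|K KP]; first exact: t2.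
apply: ereal_sup_ubound; exists (mu \o K) => //; split.
  by apply: subprob_bind => // t; have [] := KP t.
move=> h h0 /=; have K0 : expect (K h).
  by apply: kernel_expect => // t; have [] := KP t.
apply: le_trans (muT _ K0) _; apply: tight_le => // t.
by have [_] := KP t; exact.
Qed.

Lemma iv_ge0 (R : realType) phi s : 0 <= iv R phi s.
Proof. by rewrite /iv; case: ifP. Qed.

(** A resolution of an enabled branch resolves the choice; a disabled branch contributes 0, which
    the zero resolution covers. *)
Lemma tight_gchoice (R : realType) phi1 phi2 (T1 T2 : expec R -> expec R) :
  tight T1 -> tight T2 ->
  tight (fun g s => maxe (iv R phi1 s * T1 g s) (iv R phi2 s * T2 g s)).
Proof.
move=> [T10 t1] [T20 t2].
set T := fun g s => _.
have T0 : forall g, expect g -> expect (T g).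
  by move=> g g0 s; rewrite /T le_max mule_ge0// ?iv_ge0//; exact: T10.
split => // g s g0; have r0 := resolves0 s T0.
have sup0 : 0 <= ereal_sup [set mu g | mu in resolves T s].
  by apply: ereal_sup_ubound; exists (fun=> 0).
rewrite /T ge_max; apply/andP; split; rewrite {1}/iv; case: ifPn => phis;
  rewrite ?mul0e ?mul1e//.
- apply: le_trans (t1 _ _ g0) _; apply: le_ereal_sup => _ [mu [smu muT] <-].
  exists mu => //; split=> // h h0; apply: le_trans (muT _ h0) _.
  by rewrite /T {1}/iv phis mul1e le_max lexx.
- apply: le_trans (t2 _ _ g0) _; apply: le_ereal_sup => _ [mu [smu muT] <-].
  exists mu => //; split=> // h h0; apply: le_trans (muT _ h0) _.
  by rewrite /T {2}/iv phis mul1e le_max lexx orbT.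
Qed.

Lemma tight_pchoice (R : realType) (p : State -> R) (T1 T2 : expec R -> expec R) :
  (forall s, (0 <= p s <= 1)%R) -> tight T1 -> tight T2 ->
  tight (fun g s => (p s)%:E * T1 g s + (1 - p s)%:E * T2 g s).
Proof.
move=> p01 [T10 t1] [T20 t2].
have p0 s : (0 <= p s)%R by have /andP[] := p01 s.
have q0 s : (0 <= 1 - p s)%R by rewrite subr_ge0; have /andP[] := p01 s.
set T := fun g s => _.
have T0 : forall g, expect g -> expect (T g).
  move=> g g0 s; rewrite /T adde_ge0// mule_ge0// ?lee_fin ?p0 ?q0//.
    exact: T10.
  exact: T20.
split => // g s g0.
have [a [ai a0 aP ac]] := sup_resolves_seq s T10 g0.
have [b [bi b0 bP bc]] := sup_resolves_seq s T20 g0.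
apply: (@le_trans _ _ ((p s)%:E * ereal_sup [set mu g | mu in resolves T1 s] +
    (1 - p s)%:E * ereal_sup [set mu g | mu in resolves T2 s])).
  by rewrite /T leeD// lee_wpmul2l// ?lee_fin// ?t1 ?t2.
have sa : 0 <= ereal_sup [set mu g | mu in resolves T1 s].
  by apply: (cvge_to_ge ac); exact: nearW.
have sb : 0 <= ereal_sup [set mu g | mu in resolves T2 s].
  by apply: (cvge_to_ge bc); exact: nearW.
(* The branches are resolved independently; a common index [k] turns the sum of two suprema into a
   single limit. *)
have abc : (fun k => (p s)%:E * a k + (1 - p s)%:E * b k) @ \oo -->
   (p s)%:E * ereal_sup [set mu g | mu in resolves T1 s] +
    (1 - p s)%:E * ereal_sup [set mu g | mu in resolves T2 s].
  apply: cvgeD; first by rewrite ge0_adde_def// inE mule_ge0// lee_fin.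
  + exact: cvgeZl.
  + exact: cvgeZl.
apply: (cvge_to_le abc); apply: nearW => k.
have [mu [smu muT] amu] := aP k; have [nu [snu nuT] bnu] := bP k.
apply: (@le_trans _ _ ((p s)%:E * mu g + (1 - p s)%:E * nu g)).
  by rewrite leeD// lee_wpmul2l// lee_fin.
apply: ereal_sup_ubound; exists (fun g => (p s)%:E * mu g + (1 - p s)%:E * nu g) => //.
split; first by apply: subprob_mix => //; rewrite addrC subrK.
by move=> h h0; rewrite /T leeD// lee_wpmul2l// ?lee_fin// ?muT ?nuT.
Qed.

(** * Least fixpoints and tightness of loops *)

Lemma lfp_ge0 (R : realType) (F : expec R -> expec R) : expect (lfp F).
Proof. by move=> s; apply: le_ereal_inf_tmp => _ [g [g0 _] <-]; exact: g0. Qed.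

Lemma lfp_le (R : realType) (F : expec R -> expec R) g s :
  expect g -> (forall t, F g t <= g t) -> lfp F s <= g s.
Proof. by move=> g0 Fg; apply: ereal_inf_lbound; exists g. Qed.

Lemma lfp_prefixed (R : realType) (F : expec R -> expec R) s :
  (forall g h, expect g -> (forall t, g t <= h t) -> forall t, F g t <= F h t) ->
  F (lfp F) s <= lfp F s.
Proof.
move=> Fmono; apply: le_ereal_inf_tmp => _ [g [g0 Fg] <-].
apply: le_trans (Fg s); apply: Fmono; first exact: lfp_ge0.
by move=> t; exact: lfp_le.
Qed.

(** Convertible to the functional under [lfp] in the loop case of [awp], with the transformer of the
    body abstracted. *)
Definition loop_step (R : realType) (phi : pred_st) (T : expec R -> expec R)
    (f g : expec R) : expec R :=
  fun s => iv R (fun t => ~~ phi t) s * f s + iv R phi s * T g s.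

Lemma loop_stepE (R : realType) phi (T : expec R -> expec R) f g s :
  loop_step phi T f g s = if phi s then T g s else f s.
Proof.
by rewrite /loop_step /iv; case: (phi s); rewrite /= !mul0e mul1e ?add0e ?adde0.
Qed.

(** The supremum [G] of the resolutions of the loop is a prefixed point: under the guard, a
    resolution of the body followed by resolutions of the loop resolves the loop; elsewhere the
    Dirac functional does. *)
Lemma tight_while (R : realType) phi (T : expec R -> expec R) :
  tight T -> tight (fun f => lfp (loop_step phi T f)).
Proof.
move=> tT; have [T0 Tsup] := tT; set L := fun f => lfp _.
have L0 : forall g, expect g -> expect (L g) by move=> g _; exact: lfp_ge0.
have LP h t : loop_step phi T h (L h) t <= L h t.
  apply: lfp_prefixed => g g' g0 gg' s; rewrite !loop_stepE; case: ifP => // _.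
  exact: tight_le.
split => // g s g0.
pose G t := ereal_sup [set mu g | mu in resolves L t].
have G0 : expect G.
  by move=> t; apply: ereal_sup_ubound; exists (fun=> 0) => //; exact: resolves0.
(* L lies below every prefixed point, so no Kleene iteration is needed. *)
suff GP t : loop_step phi T g G t <= G t by exact: (lfp_le s G0 GP).
rewrite loop_stepE; case: ifPn => [phit|Nphit].
  apply: le_trans (Tsup _ _ G0) _; apply: ge_ereal_sup => _ [mu [smu muT] <-].
  apply: (subprob_le_bind L0 g0 smu G0) => [//|K KP].
  apply: ereal_sup_ubound; exists (mu \o K) => //; split.
    by apply: subprob_bind => // t'; have [] := KP t'.
  move=> h h0 /=; have K0 : expect (K h).
    by apply: kernel_expect => // t'; have [] := KP t'.
  apply: le_trans (muT _ K0) _; apply: le_trans (LP h t).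
  rewrite loop_stepE phit; apply: tight_le => // t'.
  by have [_] := KP t'; exact.
apply: ereal_sup_ubound; exists (fun g => g t) => //; split.
  exact: subprob_dirac.
by move=> h h0; apply: le_trans (LP h t); rewrite loop_stepE (negbTE Nphit).
Qed.

Lemma awp_tight (R : realType) (c : prog R) : wf c -> tight (awp c).
Proof.
elim: c => [|x E|c1 IH1 c2 IH2|phi1 c1 IH1 phi2 c2 IH2
  |p c1 IH1 c2 IH2|phi c IH I] /=.
- by move=> _; exact: tight_id.
- by move=> _; exact: tight_assign.
- by move=> [/IH1 t1 /IH2 t2]; exact: tight_comp.
- by move=> [_ [/IH1 t1 /IH2 t2]]; exact: tight_gchoice.
- by move=> [p01 [/IH1 t1 /IH2 t2]]; exact: tight_pchoice.
- by move=> [_ /IH t]; exact: tight_while.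
Qed.

(** * Expected runtimes compared with preexpectations *)

Lemma ert_expect (R : realType) (c : prog R) f : wf c -> expect f -> expect (ert c f).
Proof.
elim: c f => [|x E|c1 IH1 c2 IH2|phi1 c1 IH1 phi2 c2 IH2
  |p c1 IH1 c2 IH2|phi c IH I] f /=.
- by move=> _ f0 s; rewrite adde_ge0.
- by move=> _ f0 s; rewrite adde_ge0.
- by move=> [w1 w2] f0; apply: IH1 => //; exact: IH2.
- move=> [_ [w1 w2]] f0 s; rewrite adde_ge0// le_max mule_ge0 ?iv_ge0//.
  exact: (IH1 _ w1 f0 s).
- move=> [p01 [w1 w2]] f0 s; have /andP[p0 p1] := p01 s.
  by rewrite !adde_ge0// mule_ge0// ?lee_fin ?subr_ge0//;
    [exact: (IH1 _ w1 f0 s)|exact: (IH2 _ w2 f0 s)].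
- by move=> _ _; exact: lfp_ge0.
Qed.

Lemma ert_le (R : realType) (c : prog R) f g s : wf c ->
  (forall t, f t <= g t) -> ert c f s <= ert c g s.
Proof.
elim: c f g s => [|x E|c1 IH1 c2 IH2|phi1 c1 IH1 phi2 c2 IH2
  |p c1 IH1 c2 IH2|phi c IH I] f g s /=.
- by move=> _ fg; rewrite leeD2l.
- by move=> _ fg; rewrite leeD2l.
- by move=> [w1 w2] fg; apply: IH1 => // t; exact: IH2.
- move=> [_ [w1 w2]] fg; rewrite leeD2l// ge_max !le_max.
  rewrite (lee_wpmul2l _ (IH1 f g s w1 fg)) ?iv_ge0//.
  by rewrite (lee_wpmul2l _ (IH2 f g s w2 fg)) ?iv_ge0// orbT.
- move=> [p01 [w1 w2]] fg; have /andP[p0 p1] := p01 s; rewrite leeD2l// leeD//.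
    by rewrite lee_wpmul2l ?lee_fin// IH1.
  by rewrite lee_wpmul2l ?lee_fin ?subr_ge0// IH2.
- move=> [_ w] fg; apply: le_ereal_inf => _ [h [h0 hP] <-]; exists h => //.
  split => // t; apply: le_trans (hP t); rewrite leeD2l// leeD2r//.
  by rewrite lee_wpmul2l ?iv_ge0.
Qed.

(** The calculi differ only by the unit costs in [ert]; for a loop, every prefixed point of the
    runtime functional is one of the [awp] functional. *)
Lemma awp_le_ert (R : realType) (c : prog R) f s : wf c -> expect f ->
  awp c f s <= ert c f s.
Proof.
have le1D (x y : \bar R) : x <= y -> x <= 1 + y.
  by move=> xy; rewrite -[x]add0e leeD.
elim: c f s => [|x E|c1 IH1 c2 IH2|phi1 c1 IH1 phi2 c2 IH2
  |p c1 IH1 c2 IH2|phi c IH I] f s /=.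
- by move=> _ _; exact: le1D.
- by move=> _ _; exact: le1D.
- move=> [w1 w2] f0; apply: (@le_trans _ _ (ert c1 (awp c2 f) s)).
    by apply: IH1 => //; exact: (awp_tight w2).1.
  by apply: ert_le => // t; exact: IH2.
- move=> [_ [w1 w2]] f0; apply: le1D; rewrite ge_max !le_max.
  rewrite (lee_wpmul2l _ (IH1 f s w1 f0)) ?iv_ge0//.
  by rewrite (lee_wpmul2l _ (IH2 f s w2 f0)) ?iv_ge0// orbT.
- move=> [p01 [w1 w2]] f0; have /andP[p0 p1] := p01 s; apply: le1D; rewrite leeD//.
    by rewrite lee_wpmul2l ?lee_fin// IH1.
  by rewrite lee_wpmul2l ?lee_fin ?subr_ge0// IH2.
- move=> [_ w] f0; apply: le_ereal_inf => _ [h [h0 hP] <-]; exists h => //.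
  split => // t; apply: le_trans (hP t); apply: le1D; rewrite leeD2l//.
  by rewrite lee_wpmul2l ?iv_ge0// IH.
Qed.

Lemma awps_expect (R : realType) (c : prog R) f : wf c -> expect f -> expect (awps c f).
Proof.
elim: c f => [|x E|c1 IH1 c2 IH2|phi1 c1 IH1 phi2 c2 IH2
  |p c1 IH1 c2 IH2|phi c IH I] f //=.
- by move=> _ f0 s; exact: f0.
- by move=> [w1 w2] f0; apply: IH1 => //; exact: IH2.
- move=> [_ [w1 w2]] f0 s; rewrite le_max mule_ge0 ?iv_ge0//.
  exact: (IH1 _ w1 f0 s).
- move=> [p01 [w1 w2]] f0 s; have /andP[p0 p1] := p01 s.
  by rewrite !adde_ge0// mule_ge0// ?lee_fin ?subr_ge0//;
    [exact: (IH1 _ w1 f0 s)|exact: (IH2 _ w2 f0 s)].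
- by case.
Qed.

(** Unrolling the loop once pays one unit for the guard, and [awp_le_ert] discards the cost of the
    body. This is a Foster-Lyapunov drift condition with potential [X]. *)
Lemma dPAST_potential (R : realType) phi (body : prog R) I
    (X := ert (While phi body I) (fun=> 0)) s :
  wf body -> phi s -> 1 + awp body X s <= X s.
Proof.
move=> wb phis; have X0 : expect X by exact: lfp_ge0.
apply: le_trans (@lfp_prefixed R _ s _); last first.
  move=> g h _ gh t; rewrite leeD2l// leeD2l// lee_wpmul2l ?iv_ge0//.
  exact: ert_le.
by rewrite /iv phis /= mul0e add0e mul1e leeD2l// awp_le_ert.
Qed.

(** * Survival and lifetime of a fixed kernel *)

Lemma kernel_iter (R : realType) (K : expec R -> expec R) n :
  kernel K -> kernel (iter n K).
Proof.
move=> kK; elim: n => [|n IH] s; first exact: subprob_dirac.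
exact: (subprob_bind (kK s) IH).
Qed.

(* The sum of [iter k K 1] over k < n: the expected number of the first n steps
   in which K has not stopped. *)
Definition lifetime (R : realType) (K : expec R -> expec R) n : expec R :=
  iter n (fun g s => 1 + K g s) (fun=> 0).

Lemma lifetime_step (R : realType) (K : expec R -> expec R) n s :
  lifetime K n.+1 s = 1 + K (lifetime K n) s.
Proof. by []. Qed.

Section kernel_theory.
Variables (R : realType) (K : expec R -> expec R).
Hypothesis kK : kernel K.

Lemma iter_kernel_expect n g : expect g -> expect (iter n K g).
Proof. exact/kernel_expect/kernel_iter. Qed.

Lemma lifetime_expect n : expect (lifetime K n).
Proof.
elim: n => [|n IH] s //; rewrite lifetime_step adde_ge0//.
exact: kernel_expect.
Qed.

Let expect1 : expect (fun=> 1 : \bar R). Proof. by []. Qed.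

(** Mass lost by [K] stands for termination, so [iter n K (fun=> 1) s] is the probability of
    surviving [n] steps from [s]. *)
Lemma survival_le1 n s : iter n K (fun=> 1) s <= 1.
Proof. exact: (subprob1 (kernel_iter n kK s)). Qed.

Lemma survival_nonincreasing s :
  {homo (fun n => iter n K (fun=> 1) s) : m n / (m <= n)%N >-> n <= m}.
Proof.
apply: homo_leq => [//|y x z xy yz|n]; first exact: le_trans yz xy.
rewrite iterSr; apply: (subprob_le (kernel_iter n kK s)); first exact: kernel_expect.
by move=> t; exact: (survival_le1 1).
Qed.

(** The definition adds a step in front; adding it at the back exhibits [lifetime] as the partial
    sums of the survival probabilities. *)
Lemma lifetimeS n s : lifetime K n.+1 s = lifetime K n s + iter n K (fun=> 1) s.
Proof.
elim: n s => [|n IH] s.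
  by rewrite lifetime_step (subprob_cst0 (kK s)) addeC.
rewrite lifetime_step (funext IH).
rewrite (subprobD (kK s)); [|exact: lifetime_expect|exact: iter_kernel_expect].
by rewrite addeA -lifetime_step IH.
Qed.

(** The second summand is the stretch of the series from [m] to [m + n], which is how tails are
    bounded later. *)
Lemma lifetimeD m n s : lifetime K (m + n) s = lifetime K m s + iter m K (lifetime K n) s.
Proof.
elim: m s => [|m IH] s; first by rewrite add0e.
rewrite addSn lifetime_step (funext IH).
rewrite (subprobD (kK s)); [|exact: lifetime_expect|exact/iter_kernel_expect/lifetime_expect].
by rewrite addeA.
Qed.

Variable X : expec R.
Hypotheses (X0 : expect X) (Xfin : forall s, X s < +oo).
Hypothesis XK : forall s, 1 + K X s <= X s.

(** [X] is a supersolution of the recursion that defines [lifetime]. *)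
Lemma lifetime_le n s : lifetime K n s <= X s.
Proof.
elim: n s => [|n IH] s; first exact: X0.
apply: le_trans (XK s); rewrite leeD2l//.
by apply: (subprob_le (kK s)) => //; exact: lifetime_expect.
Qed.

Lemma lifetime_fin_num n s : lifetime K n s \is a fin_num.
Proof.
rewrite ge0_fin_numE ?lifetime_expect//.
exact: le_lt_trans (lifetime_le n s) (Xfin s).
Qed.

Let U s : \bar R := ereal_sup (range (fun n => lifetime K n s)).

Lemma lifetime_sup_fin_num s : U s \is a fin_num.
Proof.
rewrite ge0_fin_numE; last by apply: ereal_sup_ubound; exists 0%N.
apply: le_lt_trans (Xfin s); apply: ge_ereal_sup => _ [n _ <-].
exact: lifetime_le.
Qed.

Lemma lifetime_cvg s : (fun n => lifetime K n s) @ \oo --> U s.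
Proof.
apply: ereal_nondecreasing_cvgn; apply: homo_leq => [//|y x z|n].
  exact: le_trans.
by rewrite lifetimeS leeDl// iter_kernel_expect.
Qed.

(** These are the terms of a series with finite sum. *)
Lemma survival_cvg0 s : (fun n => iter n K (fun=> 1) s) @ \oo --> 0.
Proof.
have -> : (fun n => iter n K (fun=> 1) s) =
    (fun n => lifetime K n.+1 s - lifetime K n s).
  by apply/funext => n; rewrite lifetimeS addeAC subee ?lifetime_fin_num// add0e.
rewrite -(subee (lifetime_sup_fin_num s)); apply: cvgeB.
- by rewrite fin_num_adde_defl// fin_numN lifetime_sup_fin_num.
- by have := @lifetime_cvg s; rewrite -cvg_shiftS.
- exact: lifetime_cvg.
Qed.

Variables (I : expec R) (b : R).
Hypotheses (I0 : expect I) (Ifin : forall s, I s < +oo) (b0 : (0 <= b)%R).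
Hypothesis incr_le : forall s, K (fun t => `|I t - I s|) s <= b%:E.

Let Inum s : I s \is a fin_num. Proof. by rewrite ge0_fin_numE. Qed.

(** Each step replaces [I t] by [I s] plus the increment, whose mean under [K] is at most [b];
    summed over surviving steps this charges [b] times the lifetime. *)
Lemma iter_kernel_le n s :
  iter n K I s <= I s * iter n K (fun=> 1) s + b%:E * lifetime K n s.
Proof.
elim: n s => [|n IH] s; first by rewrite mule1 /lifetime /= mule0 adde0.
have N0 := iter_kernel_expect n expect1.
have S0 := lifetime_expect n.
apply: (@le_trans _ _ (K (fun t => (fine (I s))%:E * iter n K (fun=> 1) t +
    (`|I t - I s| + b%:E * lifetime K n t)) s)).
  apply: (subprob_le (kK s)); first exact: iter_kernel_expect.
  move=> t; apply: le_trans (IH t) _; rewrite addeA leeD2r// fineK//.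
  have -> : I t = I s + (I t - I s) by rewrite addeC subeK.
  (* An increase is paid in full, survival being at most 1; after a decrease [I s] alone
     suffices. *)
  have [It|It] := leP 0 (I t - I s).
    rewrite ge0_muleDl// leeD2l// addeAC subee// add0e gee0_abs//.
    by rewrite -[leRHS]mule1 lee_wpmul2l// survival_le1.
  rewrite -[leLHS]adde0 leeD ?abse_ge0// lee_wpmul2r//.
  by rewrite -[leRHS]adde0 leeD2l// ltW.
have a0 : expect (fun t => `|I t - I s|) by move=> t; exact: abse_ge0.
have bS0 : expect (fun t => b%:E * lifetime K n t).
  by move=> t; rewrite mule_ge0// lee_fin.
have f0 : (0 <= fine (I s))%R by exact: fine_ge0.
rewrite (subprobD (kK s)); last 2 first.
- by move=> t; rewrite mule_ge0// lee_fin.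
- by move=> t; rewrite adde_ge0.
rewrite (subprobD (kK s))// !(subprobZ (kK s))// fineK// leeD2l//.
rewrite lifetime_step ge0_muleDr//; last exact: kernel_expect.
by rewrite mule1 leeD2r.
Qed.

Lemma iter_kernel_fin_num n s : iter n K I s \is a fin_num.
Proof.
rewrite ge0_fin_numE ?iter_kernel_expect//.
apply: le_lt_trans (iter_kernel_le n s) _.
rewrite -ge0_fin_numE; last first.
  by rewrite adde_ge0// mule_ge0// ?lee_fin ?lifetime_expect ?iter_kernel_expect.
rewrite fin_numD !fin_numM ?lifetime_fin_num//.
rewrite ge0_fin_numE ?iter_kernel_expect//.
by apply: le_lt_trans (survival_le1 n s) _; rewrite ltry.
Qed.

End kernel_theory.

(** * Dominated convergence and optional stopping *)

(** Monotone convergence is applied to [g - w n], which increases to [g]; finiteness of [mu g]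
    permits subtracting back. *)
Lemma subprob_dominated_cvg0 (R : realType) (mu : expec R -> \bar R) g (w : nat -> expec R) :
  subprob mu -> expect g -> (forall t, g t < +oo) -> mu g < +oo ->
  (forall n, expect (w n)) -> (forall n t, w n t <= g t) ->
  (forall t, {homo w^~ t : m n / (m <= n)%N >-> n <= m}) ->
  (forall t, w^~ t @ \oo --> 0) -> mu \o w @ \oo --> 0.
Proof.
move=> smu g0 gfin mug w0 wg wi wc.
have gnum t : g t \is a fin_num by rewrite ge0_fin_numE.
have wnum n t : w n t \is a fin_num.
  by rewrite ge0_fin_numE ?(w0 n t)//; exact: le_lt_trans (wg n t) (gfin t).
have mugnum : mu g \is a fin_num by rewrite ge0_fin_numE// (subprob_ge0 smu).
pose v n t := g t - w n t.
have v0 n : expect (v n) by move=> t; rewrite /v sube_ge0 ?wnum ?orbT ?wg.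
have muv : mu \o v @ \oo --> mu g.
  apply: (subprob_cvg smu) => // [t m n mn|t].
    by rewrite leeB// wi.
  rewrite -[X in _ --> X]sube0; apply: cvgeB; [|exact: cvg_cst|exact: wc].
  by rewrite fin_num_adde_defl// oppe0.
have muvw n : mu (v n) + mu (w n) = mu g.
  by rewrite -(subprobD smu)//; congr mu; apply/funext => t; rewrite subeK.
have -> : mu \o w = (fun n => mu g - (mu \o v) n).
  apply/funext => n /=; rewrite -(muvw n) addeAC subee ?add0e//.
  rewrite ge0_fin_numE ?(subprob_ge0 smu)//; apply: le_lt_trans mug.
  by rewrite -(muvw n) leeDl// (subprob_ge0 smu).
rewrite -(subee mugnum); apply: cvgeB; [|exact: cvg_cst|exact: muv].
by rewrite fin_num_adde_defl// fin_numN.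
Qed.

Section optional_stopping.
Variables (R : realType) (K : expec R -> expec R) (X I : expec R) (b : R).
Hypotheses (kK : kernel K) (X0 : expect X) (Xfin : forall s, X s < +oo).
Hypothesis XK : forall s, 1 + K X s <= X s.
Hypotheses (I0 : expect I) (Ifin : forall s, I s < +oo) (b0 : (0 <= b)%R).
Hypothesis incr_le : forall s, K (fun t => `|I t - I s|) s <= b%:E.

Lemma iter_kernel_small (d : R) s : (0 < d)%R -> exists n, iter n K I s <= d%:E.
Proof.
move=> d0.
have Inum t : I t \is a fin_num by rewrite ge0_fin_numE.
pose U := ereal_sup (range (fun n => lifetime K n s)).
have Unum : U \is a fin_num by exact: (lifetime_sup_fin_num kK X0).
(* Chosen so that [b * c] is at most [d / 2]; the added 1 covers [b = 0]. *)
pose c := (d / 2 / (b + 1))%R.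
have b1 : (0 < b + 1)%R by rewrite ltr_wpDl.
have c0 : (0 < c)%R by rewrite !divr_gt0.
have [_ [m _ <-] mU] := ub_ereal_sup_adherent c0 Unum.
(* [m] is fixed before [n]: what the lifetime gains after [m] steps is at most [c] for every [n]. *)
have tail n : iter m K (lifetime K n) s <= c%:E.
  rewrite -(@leeD2lE _ (lifetime K m s)) ?(lifetime_fin_num kK X0 Xfin XK)//.
  rewrite -lifetimeD//; apply: (@le_trans _ _ U).
    by apply: ereal_sup_ubound; exists (m + n)%N.
  by rewrite -leeBlDr// ltW.
pose w n t := I t * iter n K (fun=> 1) t.
have N0 n : expect (iter n K (fun=> 1)) by exact: iter_kernel_expect.
have w0 n : expect (w n) by move=> t; rewrite mule_ge0// N0.
have wcvg : (fun n => iter m K (w n) s) @ \oo --> 0.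
  (* The dominating function is [I], integrable under [iter m K] by [iter_kernel_le]. *)
  apply: (subprob_dominated_cvg0 (kernel_iter m kK s) I0 Ifin) => //.
  - rewrite -ge0_fin_numE ?iter_kernel_expect//.
    exact: (iter_kernel_fin_num kK X0 Xfin XK I0 Ifin b0).
  - by move=> n t; rewrite -[leRHS]mule1 lee_wpmul2l// survival_le1.
  - by move=> t i j ij; rewrite lee_wpmul2l// survival_nonincreasing.
  - move=> t; rewrite -(mule0 (I t)); apply: cvgeZl => //.
    exact: (survival_cvg0 kK X0 Xfin XK).
have [n wn] : exists n, iter m K (w n) s <= (d / 2)%:E.
  apply: contrapT => /forallNP wd.
  suff : (d / 2)%:E <= 0 by rewrite leNgt lte_fin divr_gt0.
  apply: (cvge_to_ge wcvg); apply: nearW => n.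
  by apply: ltW; rewrite ltNge; apply/negP/wd.
exists (m + n)%N; rewrite iterD.
have bS0 : expect (fun t => b%:E * lifetime K n t).
  by move=> t; rewrite mule_ge0 ?lee_fin ?lifetime_expect.
apply: (@le_trans _ _ (iter m K (fun t => w n t + b%:E * lifetime K n t) s)).
  apply: (subprob_le (kernel_iter m kK s)); first exact: iter_kernel_expect.
  by move=> t; exact: iter_kernel_le.
rewrite (subprobD (kernel_iter m kK s))//.
rewrite (subprobZ (kernel_iter m kK s))//; last exact: lifetime_expect.
apply: (@le_trans _ _ ((d / 2)%:E + b%:E * c%:E)).
  by rewrite leeD// lee_wpmul2l ?lee_fin.
rewrite -EFinM -EFinD lee_fin [leRHS]splitr lerD2l /c mulrCA.
by rewrite -[leRHS]mulr1 ler_pM2l ?divr_gt0// ler_pdivrMr// mul1r lerDl.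
Qed.

(** With [h] the payoff on stopping, unrolling compares the approximate subinvariant [I] with the
    superinvariant [g]: each surviving step loses [e], and the remainder [iter n K I] becomes small
    at [s]. *)
Lemma optional_stopping (h g : expec R) (e : R) : (0 <= e)%R ->
  expect h -> expect g ->
  (forall s, I s <= h s + K I s + e%:E) -> (forall s, h s + K g s <= g s) ->
  forall s, I s <= g s + e%:E * X s.
Proof.
move=> e0 h0 g0 Isub gsup s.
have bound n t : I t <= g t + e%:E * lifetime K n t + iter n K I t.
  elim: n t => [|n IH] t; first by rewrite leeDr// adde_ge0// mule_ge0// lee_fin.
  have eS0 : expect (fun t => e%:E * lifetime K n t).
    by move=> t'; rewrite mule_ge0 ?lee_fin ?lifetime_expect.
  have KI0 : expect (iter n K I) by exact: iter_kernel_expect.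
  apply: le_trans (Isub t) _.
  have : K I t <= K g t + e%:E * K (lifetime K n) t + K (iter n K I) t.
    rewrite -(subprobZ (kK t))//; last exact: lifetime_expect.
    rewrite -(subprobD (kK t))// -(subprobD (kK t))//.
      exact: (subprob_le (kK t)).
    by move=> t'; rewrite adde_ge0.
  move=> KI; apply: (@le_trans _ _ (h t +
      (K g t + e%:E * K (lifetime K n) t + K (iter n K I) t) + e%:E)).
    by rewrite leeD2r// leeD2l.
  rewrite lifetime_step ge0_muleDr//; last first.
    by apply: kernel_expect => //; exact: lifetime_expect.
  rewrite mule1 -/(iter n.+1 K I).
  have -> : h t + (K g t + e%:E * K (lifetime K n) t + K (iter n K I) t) + e%:E =
    (h t + K g t) + (e%:E + e%:E * K (lifetime K n) t) + K (iter n K I) t.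
    rewrite !addeA -!addeA; congr (_ + (_ + _)).
    by rewrite addeA addeC.
  by rewrite leeD2r// leeD2r.
(* Only the remainder depends on the choice of [n]; the accumulated loss is bounded by [e * X s]
   uniformly. *)
apply/lee_addgt0Pr => d d0; have [n nd] := iter_kernel_small s d0.
apply: le_trans (bound n s) _; rewrite leeD// leeD2l// lee_wpmul2l ?lee_fin//.
exact: (lifetime_le kK X0 XK).
Qed.

End optional_stopping.

(** * Soundness for loops and for whole programs *)

(** As [awp] of the loop is an infimum, [I] is compared with each prefixed point [g] up to an
    arbitrary [d]. The kernel may depend on [d] and on the initial state. *)
Lemma loop_sound (R : realType) (phi : pred_st) (body : prog R) (I f : expec R) s :
  wf body -> expect I -> expect f ->
  (forall t, I t <= loop_step phi (awp body) f I t) ->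
  dPAST phi body I -> suitable_OST phi body I f ->
  I s <= awp (While phi body I) f s.
Proof.
move=> wb I0 f0 Isub Xfin [_ [_ [Ifin _]] [b [b0 incr]]].
have [T0 Tsup] := awp_tight wb.
set X := ert (While phi body I) (fun=> 0) in Xfin.
have X0 : expect X by exact: lfp_ge0.
apply: le_ereal_inf_tmp => _ [g [g0 gP] <-].
have {}gP t : loop_step phi (awp body) f g t <= g t by exact: gP.
pose h t := iv R (fun u => ~~ phi u) t * f t.
apply/lee_addgt0Pr => d d0.
have Xnum t : X t \is a fin_num by rewrite ge0_fin_numE ?X0//; exact: Xfin.
(* Makes the total loss [e * X s] at most [d]; the added 1 keeps the denominator positive. *)
pose e := (d / (fine (X s) + 1))%R.
have x0 : (0 <= fine (X s))%R by rewrite fine_ge0.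
have e0 : (0 < e)%R by rewrite divr_gt0// ltr_wpDl.
have /choice[mu muP] : forall t, exists mu, resolves (awp body) t mu /\
    (phi t -> I t - e%:E <= mu I).
  move=> t; have [phit|_] := boolP (phi t); last first.
    by exists (fun=> 0); split => //; exact: resolves0.
  (* Finiteness of [I t] makes the inequality strict, so some resolution attains the bound. *)
  have : I t - e%:E < ereal_sup [set mu I | mu in resolves (awp body) t].
    apply: lt_le_trans (Tsup _ _ I0); have := Isub t; rewrite loop_stepE phit.
    by apply: lt_le_trans; rewrite lteBlDr// lteDl ?lte_fin// ge0_fin_numE ?I0.
  by move=> /ereal_sup_gt[_ [mu rmu <-] /ltW]; exists mu.
(* Leaving the guard kills the mass, so survival under [K] means that the loop still runs. *)
pose K g t := if phi t then mu t g else 0.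
have kK : kernel K.
  move=> t; rewrite /K; case: (phi t); last exact: subprob0.
  by have [[]] := muP t.
have Kawp k t : expect k -> K k t <= iv R phi t * awp body k t.
  move=> k0; rewrite /K /iv; case: (phi t); last by rewrite mul0e.
  by rewrite mul1e; have [[_ +] _] := muP t; exact.
have XK t : 1 + K X t <= X t.
  rewrite /K; have [phit|_] := boolP (phi t).
    apply: le_trans (dPAST_potential I wb phit); rewrite leeD2l//.
    by have [[_ +] _] := muP t; exact.
  (* Outside the guard [K X t] is 0, and [X t] is at least 1 because evaluating the guard costs one
     unit. *)
  apply: le_trans (lfp_prefixed _ _); last first.
    move=> k k' _ kk' u; rewrite leeD2l// leeD2l// lee_wpmul2l ?iv_ge0//.
    exact: ert_le.
  by rewrite leeD2l// adde_ge0// mule_ge0 ?iv_ge0 ?(ert_expect wb X0).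
have Kincr t : K (fun u => `|I u - I t|) t <= b%:E.
  by apply: le_trans (incr t); apply: Kawp => u; exact: abse_ge0.
have h0 : expect h by move=> t; rewrite mule_ge0 ?iv_ge0 ?f0.
apply: le_trans (optional_stopping kK X0 Xfin XK I0 Ifin b0 Kincr (ltW e0) h0 g0 _ _ s) _.
- move=> t; rewrite -leeBlDr//; have := Isub t; rewrite loop_stepE /h /K /iv.
  case: ifPn => phit It /=; last first.
    rewrite mul1e adde0; apply: le_trans It.
    by rewrite geeDl// lee_fin oppr_le0 ltW.
  by rewrite mul0e add0e; have [_] := muP t; exact.
- by move=> t; apply: le_trans (gP t); rewrite leeD2l// Kawp.
rewrite leeD2l// -(fineK (Xnum s)) -EFinM lee_fin /e mulrAC.
by rewrite ler_pdivrMr ?ltr_wpDl// ler_pM2l// lerDl.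
Qed.

(** Nested loops force the induction over all programs: for a loop, the hypothesis on the body turns
    subinvariance under [awps] into subinvariance under [awp], as [loop_sound] requires. *)
Lemma vc_sound (R : realType) (c : prog R) f s : wf c -> expect f ->
  vc (@dPASTSUBINV R) c f -> awps c f s <= awp c f s.
Proof.
elim: c f s => [|x E|c1 IH1 c2 IH2|phi1 c1 IH1 phi2 c2 IH2
  |p c1 IH1 c2 IH2|phi c IH I] f s //.
- move=> /= [w1 w2] f0 [v1 v2]; have a0 := awps_expect w2 f0.
  apply: le_trans (IH1 _ s w1 a0 v1) _.
  by apply: (tight_le s (awp_tight w1)) => // t; exact: IH2.
- move=> /= [_ [w1 w2]] f0 [v1 v2]; rewrite ge_max !le_max.
  rewrite (lee_wpmul2l _ (IH1 f s w1 f0 v1)) ?iv_ge0//.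
  by rewrite (lee_wpmul2l _ (IH2 f s w2 f0 v2)) ?iv_ge0// orbT.
- move=> /= [p01 [w1 w2]] f0 [v1 v2]; have /andP[p0 p1] := p01 s; rewrite leeD//.
    by rewrite lee_wpmul2l ?lee_fin// IH1.
  by rewrite lee_wpmul2l ?lee_fin ?subr_ge0// IH2.
- move=> [I0 w] f0 [[Isub past suit] v]; apply: loop_sound => // t.
  apply: le_trans (Isub t) _; rewrite addeC leeD2l// lee_wpmul2l ?iv_ge0//.
  exact: IH.
Qed.

Theorem theorem6p12 (R : realType) (phi : pred_st) (body : prog R) (I : expec R)
    (f : expec R) :
  wf (While phi body I) -> expect f ->
  vc (@dPASTSUBINV R) (While phi body I) f ->
  forall s, I s <= awp (While phi body I) f s.
Proof. by move=> w f0 v s; exact: (vc_sound s w f0 v). Qed.
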